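(* Let $q$ be a prime power, $P \in \mathbb{F}_q[x]$ an irreducible polynomial, $k \geq 1$, and let $D_1, D_2$ be two subsets of $\mathrm{Div}(P^k)$ with $P^k \notin D_1$ and $P^k \notin D_2$. Then the following statements are equivalent: (1) $D_1 = D_2$; (2) $G_{P^k}(D_1)$ and $G_{P^k}(D_2)$ are isomorphic; (3) $G_{P^k}(D_1)$ and $G_{P^k}(D_2)$ are isospectral.
   Context: For a nonconstant $f \in \mathbb{F}_q[x]$, $\mathrm{Div}(f)$ is the set of divisors of $f$ up to multiplication by nonzero constants; for $D \subset \mathrm{Div}(f)$ with $f \notin D$, the gcd-graph $G_f(D)$ is the simple undirected graph with vertex set $\mathbb{F}_q[x]/f$ in which $a,b$ are adjacent iff $\gcd(a-b,f) \in D$ (gcd taken up to nonzero constants). Two graphs are isospectral if their adjacency matrices have the same eigenvalues with multiplicities. *)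

(* Defs.v *)
From HB Require Import structures.
From mathcomp Require Import all_boot all_order all_algebra all_field.
From mathcomp Require Import finmap.
Set Implicit Arguments.
Unset Strict Implicit.
Unset Printing Implicit Defensive.
Import GRing.Theory.
Local Open Scope ring_scope.

Record sgraph : Type := SGraph {
  vertex : finType;
  adj : rel vertex;
  adj_sym : symmetric adj;
  adj_irr : irreflexive adj }.

Definition isomorphic (G H : sgraph) : Prop :=
  exists2 phi : vertex G -> vertex H,
    bijective phi & forall x y, adj (phi x) (phi y) = adj x y.

Definition adj_mx (G : sgraph) : 'M[algC]_#|vertex G| :=
  \matrix_(i, j) (adj (enum_val i) (enum_val j))%:R.

Definition eig_mult (n : nat) (A : 'M[algC]_n) (lambda : algC) : nat :=
  mup lambda (char_poly A).

Definition isospectral (G H : sgraph) : Prop :=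
  eig_mult (adj_mx G) =1 eig_mult (adj_mx H).

(* The monic polynomial in the class of p up to nonzero constants
   (and 0 for p = 0). *)
Definition normp (F : fieldType) (p : {poly F}) : {poly F} :=
  (lead_coef p)^-1 *: p.

Lemma normp_monic (F : fieldType) (p : {poly F}) :
  p != 0 -> normp p \is monic.
Proof.
by move=> p0; rewrite monicE lead_coefZ mulVf ?lead_coef_eq0.
Qed.

Lemma eqp_normp (F : fieldType) (p q : {poly F}) :
  (normp p == normp q) = (p %= q).
Proof.
have E (r : {poly F}) : normp r %= r.
  have [->|r0] := eqVneq r 0; first by rewrite /normp scaler0 eqpxx.
  by rewrite /normp eqp_scale // invr_eq0 lead_coef_eq0.
apply/eqP/idP => [e|pq].
  by rewrite -(eqp_ltrans (E p)) e E.
have [p0|p0] := eqVneq p 0.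
  by move: pq; rewrite p0 eqp_sym eqp0 => /eqP->.
have q0 : q != 0 by rewrite -eqp0 -(eqp_ltrans pq) eqp0.
apply/eqP; rewrite -eqp_monic ?normp_monic //.
by rewrite (eqp_ltrans (E p)) (eqp_rtrans (E q)).
Qed.

(* A class of divisors up to nonzero constants is represented by its unique
   monic member. *)
Definition Div (F : fieldType) (f : {poly F}) : {pred {poly F}} :=
  [pred g : {poly F} | (g \is monic) && (g %| f)].

Section GcdGraph.
Variables (F : finFieldType) (f : {poly F}) (D : {fset {poly F}}).

(* The quotient type {poly %/ h} is F[x]/(h) only for h monic and nonconstant,
   whence the normalization of f.  Its elements are the reduced
   representatives, and coerce to {poly F}. *)
Definition gcd_adj : rel {poly %/ normp f} :=
  fun a b => normp (gcdp ((a - b : {poly %/ normp f}) : {poly F}) f) \in D.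

Lemma gcd_adj_sym : symmetric gcd_adj.
Proof.
move=> a b; rewrite /gcd_adj.
suff /eqP-> : normp (gcdp ((a - b : {poly %/ normp f}) : {poly F}) f)
           == normp (gcdp ((b - a : {poly %/ normp f}) : {poly F}) f) by [].
rewrite eqp_normp; apply: eqp_gcdl; rewrite -opprB /=.
by rewrite -scaleN1r eqp_scale // oppr_eq0 oner_eq0.
Qed.

Lemma gcd_adj_irr : normp f \notin D -> irreflexive gcd_adj.
Proof. by move=> fD a; rewrite /gcd_adj subrr gcd0p (negPf fD). Qed.

Definition gcd_graph (fD : normp f \notin D) : sgraph :=
  SGraph gcd_adj_sym (gcd_adj_irr fD).

End GcdGraph.

(* Main.v *)
(* Both an isomorphism and isospectrality preserve the number of ordered pairs
   of adjacent vertices, which is the trace of the square of the adjacency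
   matrix.  In a gcd-graph this number is #|F[x]/P^k| times the number of
   residues c with gcd(c, P^k) in D, so it suffices to recover D from the latter.
   Sort the residues by their P-adic valuation.  Translation by P^i maps the
   residues of valuation > i injectively to residues of valuation i; hence for
   i < k there are at least as many residues of valuation exactly i as of
   valuation > i, the zero residue included, and the set of valuations selected
   by D is determined by the total count, as in a superincreasing sum. *)
Require Import Defs.
From mathcomp Require Import all_boot all_order all_algebra all_field.
From mathcomp Require Import finmap.
Set Implicit Arguments.
Unset Strict Implicit.
Unset Printing Implicit Defensive.
Import GRing.Theory Num.Theory.
Local Open Scope ring_scope.

Definition num_arcs (G : sgraph) : nat :=
  \sum_(x : vertex G) \sum_(y : vertex G) adj x y.

Lemma isomorphic_num_arcs (G H : sgraph) :
  isomorphic G H -> num_arcs G = num_arcs H.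
Proof.
case=> phi bij_phi phi_adj; rewrite /num_arcs [RHS](reindex phi) /=; last first.
  exact: onW_bij.
apply: eq_bigr => x _; rewrite [RHS](reindex phi) /=; last exact: onW_bij.
by apply: eq_bigr => y _; rewrite phi_adj.
Qed.

(** By the spectral theorem [A] is conjugate to a diagonal matrix, and both the characteristic
    polynomial and the trace of the square are invariant under conjugation. *)
Lemma char_poly_trace_sqr_normal (C : numClosedFieldType) (n : nat)
    (A : 'M[C]_n) : A \is normalmx ->
  exists2 s : seq C, char_poly A = \prod_(x <- s) ('X - x%:P)
                   & \tr (A *m A) = \sum_(x <- s) x ^+ 2.
Proof.
move/orthomx_spectralP; set U := spectralmx A; set d := spectral_diag A => defA.
have uU : U \in unitmx by exact: spectral_unit.
exists [seq d 0 i | i <- enum 'I_n].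
  rewrite big_map big_enum /=.
  have -> : \prod_(i < n) ('X - (d 0 i)%:P) = char_poly (diag_mx d).
    rewrite char_poly_trig ?diag_mx_is_trig //.
    by apply: eq_bigr => i _; rewrite mxE eqxx.
  have uUX : map_mx polyC (invmx U) *m map_mx polyC U = 1%:M.
    by rewrite -map_mxM mulVmx // map_mx1.
  (* The scalar matrix ['X%:M] is conjugated as well, so that the conjugating factors can be pulled
     out of the difference. *)
  rewrite /char_poly /char_poly_mx {1}defA !map_mxM.
  have {1}-> : 'X%:M = map_mx polyC (invmx U) *m 'X%:M *m map_mx polyC U.
    by rewrite mul_mx_scalar -scalemxAl uUX scalemx1.
  rewrite -mulmxBl -mulmxBr !det_mulmx mulrC mulrA -det_mulmx.
  by rewrite (mulmx1C uUX) det1 mul1r.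
rewrite big_map big_enum /=.
have -> : A *m A = invmx U *m (diag_mx d *m diag_mx d *m U).
  by rewrite {1 2}defA !mulmxA mulmxK.
rewrite mxtrace_mulC mulmxK // mulmx_diag mxtrace_diag.
by apply: eq_bigr => i _; rewrite mxE expr2.
Qed.

Lemma adj_mx_normal (G : sgraph) : adj_mx G \is normalmx.
Proof.
apply: symmetric_normalmx.
  by apply/is_hermitianmxP; rewrite expr0 scale1r map_mx_id //;
    apply/matrixP => i j; rewrite !mxE adj_sym.
by apply/mxOverP => i j; rewrite mxE realn.
Qed.

Lemma trace_adj_mx_sqr (G : sgraph) :
  \tr (adj_mx G *m adj_mx G) = (num_arcs G)%:R.
Proof.
rewrite /num_arcs natr_sum [RHS](reindex (@enum_val _ (vertex G))) /=; last first.
  exact: (onW_bij _ (@enum_val_bij _)).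
apply: eq_bigr => i _; rewrite mxE natr_sum [RHS](reindex (@enum_val _ (vertex G))) /=; last first.
  exact: (onW_bij _ (@enum_val_bij _)).
by apply: eq_bigr => j _; rewrite !mxE adj_sym -natrM mulnb andbb.
Qed.

Lemma isospectral_num_arcs (G H : sgraph) :
  isospectral G H -> num_arcs G = num_arcs H.
Proof.
have [s Gs trG] := char_poly_trace_sqr_normal (adj_mx_normal G).
have [t Ht trH] := char_poly_trace_sqr_normal (adj_mx_normal H).
move=> GH; apply: (mulrIn (oner_neq0 algC)).
rewrite -!trace_adj_mx_sqr trG trH; apply: perm_big.
(* The multiplicity of [x] as a root is its number of occurrences in the list, so equal
   multiplicities make [s] a permutation of [t]. *)
apply/allP => x _; apply/eqP.
by have := GH x; rewrite /eig_mult Gs Ht !mu_prod_XsubC.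
Qed.

(* At the first level i where A and B differ, the whole weight of the levels
   above i is less than that of level i, because level k is in neither. *)
Lemma level_set_card_inj (T : finType) (v : T -> nat) (k : nat)
    (A B : pred nat) :
    (forall i, i < k -> #|[pred c | i < v c]| <= #|[pred c | v c == i]|)%N ->
    (exists c, v c = k) -> ~~ A k -> ~~ B k ->
    #|[pred c | A (v c)]| = #|[pred c | B (v c)]| ->
  forall i, (i < k)%N -> A i = B i.
Proof.
move=> vP [z vz].
have suffAB X Y i : (i < k)%N -> ~~ Y k ->
    (forall j, (j < i)%N -> X j = Y j) -> X i -> ~~ Y i ->
    (#|[pred c | Y (v c)]| < #|[pred c | X (v c)]|)%N.
  move=> ik Yk XY Xi Yi.
  (* The part below level [i], common to [X] and [Y]. *)
  pose W := [set c | (v c < i)%N && X (v c)].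
  have lo : (#|W| + #|[pred c | v c == i]| <= #|[pred c | X (v c)]|)%N.
    rewrite -[#|[pred c | v c == i]|]cardsE -cardsUI -[leqRHS]cardsE.
    rewrite [_ :&: _](_ : _ = set0) ?cards0 ?addn0.
      apply/subset_leq_card/subsetP => c.
      by rewrite !inE => /orP[/andP[]//|/eqP->].
    by apply/setP => c; rewrite !inE; case: ltngtP => //=; rewrite andbF.
  apply: leq_trans lo; apply: leq_trans (leq_add (leqnn _) (vP i ik)).
  rewrite -[#|[pred c | (i < v c)%N]|]cardsE.
  (* Strictness comes from [z]: its level [k] exceeds [i] but is not selected by [Y]. *)
  have -> : (#|[pred c | Y (v c)]|.+1 = #|z |: [set c | Y (v c)]|)%N.
    by rewrite cardsU1 !inE vz Yk cardsE.
  apply: leq_trans (leq_card_setU _ _); apply/subset_leq_card/subsetP => c.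
  rewrite !inE => /orP[/eqP->|]; first by rewrite vz ik orbT.
  by case: ltngtP => [ci|_|->]; rewrite ?orbT ?(negPf Yi) //= (XY _ ci) => ->.
move=> Ak Bk cAB; elim/ltn_ind => i IH ik.
have eqAB j : (j < i)%N -> A j = B j by move=> ji; apply/IH/(ltn_trans ji).
case Ai: (A i); case Bi: (B i) => //.
  by have := suffAB A B i ik Bk eqAB Ai (negbT Bi); rewrite cAB ltnn.
have := suffAB B A i ik Ak (fun j ji => esym (eqAB j ji)) Bi (negbT Ai).
by rewrite cAB ltnn.
Qed.

Lemma dvdp_exp_irreducibleP (F : fieldType) (P g : {poly F}) (k : nat) :
  irreducible_poly P -> g %| P ^+ k ->
  exists2 i, (i <= k)%N & g %= P ^+ i.
Proof.
move=> irrP; elim: k g => [|k IH] g.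
  by rewrite expr0 dvdp1 size_poly_eq1 => g1; exists 0.
have [Pg|Pg] := boolP (P %| g).
  have P0 : P != 0 by exact: irredp_neq0.
  rewrite -(divpK Pg) exprSr dvdp_mul2r // => /IH[i ik gi].
  by exists i.+1 => //; rewrite exprSr eqp_mul2r.
rewrite exprS Gauss_dvdpr => [/IH[i ik gi]|]; first by exists i; rewrite ?leqW.
by rewrite coprimep_sym irreducible_poly_coprime.
Qed.

Section PrimePower.
Variables (F : finFieldType) (P : {poly F}) (k : nat).
Hypothesis irrP : irreducible_poly P.
Local Notation f := (P ^+ k).
Local Notation R := {poly %/ normp f}.

Fact level_subproof (c : R) :
  exists i : 'I_k.+1, gcdp (c : {poly F}) f %= P ^+ i.
Proof.
have [i ik ei] := dvdp_exp_irreducibleP irrP (dvdp_gcdr (c : {poly F}) f).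
by exists (Ordinal (ik : i < k.+1)%N).
Qed.

(* The P-adic valuation truncated at k. *)
Definition level (c : R) : nat := xchoose (level_subproof c).

Lemma gcdp_level (c : R) : gcdp (c : {poly F}) f %= P ^+ level c.
Proof. exact: (xchooseP (level_subproof c)). Qed.

Lemma level_le (c : R) : (level c <= k)%N.
Proof. by rewrite -ltnS ltn_ord. Qed.

(** The bound on [i] accounts for the truncation: every power of [P] divides 0, whose level is only
    [k]. *)
Lemma leq_level (c : R) (i : nat) :
  (i <= k)%N -> (i <= level c)%N = (P ^+ i %| (c : {poly F})).
Proof.
have [P1 _] := irrP => ik.
rewrite -(dvdp_Pexp2l _ _ P1) -(eqp_dvdr _ (gcdp_level c)) dvdp_gcd.
by rewrite (dvdp_exp2l _ ik) andbT.
Qed.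

Lemma level0 : level 0 = k.
Proof. by apply/eqP; rewrite eqn_leq level_le leq_level // dvdp0. Qed.

Lemma in_qpoly_exp (i : nat) :
  (i < k)%N -> in_qpoly (normp f) (P ^+ i) = P ^+ i :> {poly F}.
Proof.
have [P1 _] := irrP => ik.
have P0 : P != 0 by exact: irredp_neq0.
have lf : lead_coef f != 0 by rewrite lead_coef_eq0 expf_neq0.
have szX j : size (P ^+ j) = ((size P).-1 * j).+1.
  by rewrite -(prednK (_ : 0 < size (P ^+ j))%N) ?size_exp // size_poly_gt0 expf_neq0.
have ltS : (size (P ^+ i) < size (normp f))%N.
  rewrite /normp size_scale ?invr_eq0 // !szX ltnS ltn_mul2l ik andbT.
  by rewrite -ltnS prednK // ltnW.
(* [mk_monic] keeps its argument only if it is monic and nonconstant; the latter follows from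
   [ltS]. *)
apply: in_qpoly_small; rewrite /mk_monic normp_monic ?expf_neq0 // andbT.
by rewrite (leq_ltn_trans _ ltS) // szX.
Qed.

Lemma card_level (i : nat) : (i < k)%N ->
  (#|[pred c | i < level c]| <= #|[pred c | level c == i]|)%N.
Proof.
move=> ik; have [P1 _] := irrP.
rewrite -(card_image (addIr (in_qpoly (normp f) (P ^+ i)))).
apply/subset_leq_card/subsetP => _ /imageP[c lt_ic ->].
rewrite !inE in lt_ic *.
have dvd_c : P ^+ i.+1 %| (c : {poly F}) by rewrite -leq_level.
have val_c : (c + in_qpoly (normp f) (P ^+ i) : R) = (c : {poly F}) + P ^+ i
  :> {poly F} by rewrite poly_of_qpolyD in_qpoly_exp.
(* Since [P ^+ i.+1] divides [c], the sum is divisible by [P ^+ i] but not by [P ^+ i.+1]. *)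
rewrite eqn_leq leqNgt !leq_level // 1?ltnW // val_c.
rewrite (dvdp_addr _ dvd_c) dvdp_Pexp2l // ltnn /=.
by rewrite dvdp_addr ?dvdpp // (dvdp_trans _ dvd_c) // dvdp_exp2l.
Qed.

Lemma gcd_adj_level (D : {fset {poly F}}) (a b : R) :
  gcd_adj D a b = (normp (P ^+ level (a - b)) \in D).
Proof.
rewrite /gcd_adj; congr (_ \in D).
by apply/eqP; rewrite eqp_normp gcdp_level.
Qed.

Lemma num_arcs_gcd_graph (D : {fset {poly F}}) (fD : normp f \notin D) :
  num_arcs (gcd_graph fD)
  = (#|{: R}| * #|[pred c : R | normp (P ^+ level c) \in D]|)%N.
Proof.
rewrite /num_arcs /= -sum_nat_const; apply: eq_bigr => a _.
(* Writing the neighbours of [a] as [a - b] makes their number independent of [a]. *)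
rewrite -sum1_card [RHS]big_mkcond (reindex_inj (inj_comp (addrI a) oppr_inj)) /=.
by apply: eq_bigr => b _; rewrite gcd_adj_level /= opprD opprK addNKr inE; case: ifP.
Qed.

Lemma num_arcs_gcd_graph_sub (D1 D2 : {fset {poly F}})
    (fD1 : normp f \notin D1) (fD2 : normp f \notin D2) :
    {subset D1 <= Div f} ->
    num_arcs (gcd_graph fD1) = num_arcs (gcd_graph fD2) ->
  {subset D1 <= D2}.
Proof.
move=> hD1; rewrite !num_arcs_gcd_graph => /eqP.
rewrite eqn_pmul2l; last by apply/card_gt0P; exists 0.
move=> /eqP/(level_set_card_inj (A := fun i => normp (P ^+ i) \in D1)
  (B := fun i => normp (P ^+ i) \in D2) card_level
  (ex_intro _ 0 level0) fD1 fD2) eqD d dD1.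
have /andP[d_monic /(dvdp_exp_irreducibleP irrP)[i ik di]] := hD1 d dD1.
have def_d : d = normp (P ^+ i).
  have <- : normp d = d by rewrite /normp (monicP d_monic) invr1 scale1r.
  by apply/eqP; rewrite eqp_normp.
(* The case [i = k] is excluded, as it would put [normp f] in [D1]. *)
rewrite def_d -eqD -?def_d // ltn_neqAle ik andbT.
by apply: contraNneq fD1 => <-; rewrite -def_d.
Qed.

End PrimePower.

Theorem theorem4p16 (F : finFieldType) (P : {poly F}) (k : nat)
  (D1 D2 : {fset {poly F}})
  (hP : irreducible_poly P) (hk : (1 <= k)%N)
  (hD1 : {subset D1 <= Div (P ^+ k)}) (hD2 : {subset D2 <= Div (P ^+ k)})
  (fD1 : normp (P ^+ k) \notin D1) (fD2 : normp (P ^+ k) \notin D2) :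
  [<-> D1 = D2;
       isomorphic (gcd_graph fD1) (gcd_graph fD2);
       isospectral (gcd_graph fD1) (gcd_graph fD2)].
Proof.
have arcsD : num_arcs (gcd_graph fD1) = num_arcs (gcd_graph fD2) -> D1 = D2.
  move=> e; apply/fsetP => d; apply/idP/idP.
    exact: (num_arcs_gcd_graph_sub hP hD1 e).
  exact: (num_arcs_gcd_graph_sub hP hD2 (esym e)).
tfae.
- move=> eqD; subst D2; exists id; first by exists id.
  by [].
(* Isospectrality is reached through [D1 = D2], after which the two graphs differ only in the proofs
   [fD1] and [fD2]. *)
- move/isomorphic_num_arcs/arcsD => eqD; subst D2.
  by rewrite (bool_irrelevance fD1 fD2).
- by move/isospectral_num_arcs/arcsD.
Qed.
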